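(* For a graph $H$, every C6'78-problem on $H$-free graphs is polynomial-time solvable if $H$ is an induced subgraph of $P_1+P_3$ or $P_4$, and NP-complete otherwise.
   Context: A graph $G=(V,E)$ has a vertex set $V$ and an edge set $E$ consisting of unordered pairs of vertices. A statement about a problem ''on'' (or ''for'') a graph class refers to the problem with input graphs restricted to that class. A graph is $H$-free if it does not contain $H$ as an induced subgraph, that is, if no graph isomorphic to $H$ can be obtained from it by deleting vertices. $P_r$ and $C_r$ denote the path and the cycle on $r$ vertices, respectively; $G_1+G_2$ denotes the disjoint union of two vertex-disjoint graphs $G_1$ and $G_2$, and $rG$ denotes the disjoint union of $r$ copies of $G$. The line graph of a graph $G$ has as vertices the edges of $G$, with an edge between two distinct vertices $e$ and $f$ if and only if $e$ and $f$ share a common end-vertex in $G$; a graph is a line graph if it is the line graph of some graph. A problem $\Pi$ is a C6'78-problem if it satisfies the following three conditions: C6': $\Pi$ is NP-complete for $H$-free graphs if $H\in\{C_3,C_4,C_5,4P_1,2P_1+P_2,2P_2\}$; C7: $\Pi$ is polynomial-time solvable for $H$-free graphs if $H\in\{P_4,P_1+P_3\}$; C8: $\Pi$ is NP-complete for line graphs.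
   Formalization: The formal theorem additionally assumes that the problem belongs to NP on all graphs; without this, a C6'78-problem made undecidable on graphs outside all the classes in C6', C7 and C8 would not be in NP on, say, K_4-free graphs. *)

(* Defs.v *)
From Stdlib Require List.
From HB Require Import structures.
From mathcomp Require Import all_boot all_order all_algebra.

Set Implicit Arguments.
Unset Strict Implicit.
Unset Printing Implicit Defensive.

(** * Finite simple graphs *)

(* The vertex set is normalised to {0, ..., n-1}, so that a graph has a
   well-defined adjacency-matrix encoding. *)
Record graph := Graph {
  order : nat;
  adj : rel 'I_order;
  adj_sym : symmetric adj;
  adj_irr : irreflexive adj
}.

Definition vertex (G : graph) : finType := 'I_(order G).

Definition iso (G H : graph) : Prop :=
  exists2 f : vertex G -> vertex H,
    bijective f & forall x y, adj (f x) (f y) = adj x y.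

Section Induced.
Variables (G : graph) (S : {set vertex G}).

Definition induced_adj : rel 'I_#|S| :=
  fun i j => adj (enum_val i) (enum_val j).

Lemma induced_adj_sym : symmetric induced_adj.
Proof. by move=> i j; rewrite /induced_adj adj_sym. Qed.

Lemma induced_adj_irr : irreflexive induced_adj.
Proof. by move=> i; rewrite /induced_adj adj_irr. Qed.

(* The graph obtained from G by deleting the vertices outside S. *)
Definition induced : graph := Graph induced_adj_sym induced_adj_irr.
End Induced.

Definition induced_subgraph (H G : graph) : Prop :=
  exists S : {set vertex G}, iso H (induced S).

Definition graph_class := graph -> Prop.

Definition all_graphs : graph_class := fun _ => True.

Definition free (H : graph) : graph_class := fun G => ~ induced_subgraph H G.

Section PathGraph.
Variable r : nat.

Definition path_adj : rel 'I_r := fun i j => (i.+1 == j) || (j.+1 == i).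

Lemma path_adj_sym : symmetric path_adj.
Proof. by move=> i j; rewrite /path_adj orbC. Qed.

Lemma path_adj_irr : irreflexive path_adj.
Proof. by move=> i; rewrite /path_adj orbb; apply/negbTE; rewrite gtn_eqF. Qed.

Definition path_graph : graph := Graph path_adj_sym path_adj_irr.
End PathGraph.

Section CycleGraph.
Variable r : nat.

Definition cycle_adj : rel 'I_r :=
  fun i j => (i != j) && ((i.+1 %% r == j) || (j.+1 %% r == i)).

Lemma cycle_adj_sym : symmetric cycle_adj.
Proof. by move=> i j; rewrite /cycle_adj orbC eq_sym. Qed.

Lemma cycle_adj_irr : irreflexive cycle_adj.
Proof. by move=> i; rewrite /cycle_adj eqxx. Qed.

(* Meaningful for r >= 3. *)
Definition cycle_graph : graph := Graph cycle_adj_sym cycle_adj_irr.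
End CycleGraph.

Section DisjointUnion.
Variables G H : graph.

Definition union_adj : rel 'I_(order G + order H) := fun i j =>
  match split i, split j with
  | inl x, inl y => adj x y
  | inr x, inr y => adj x y
  | _, _ => false
  end.

Lemma union_adj_sym : symmetric union_adj.
Proof.
by move=> i j; rewrite /union_adj; case: split => x; case: split => y //;
  rewrite adj_sym.
Qed.

Lemma union_adj_irr : irreflexive union_adj.
Proof. by move=> i; rewrite /union_adj; case: split => x; rewrite adj_irr. Qed.

Definition disjoint_union : graph := Graph union_adj_sym union_adj_irr.
End DisjointUnion.

Fixpoint copies (r : nat) (G : graph) : graph :=
  match r with
  | 0 => path_graph 0
  | 1 => G
  | r'.+1 => disjoint_union G (copies r' G)
  end.

Section LineGraph.
Variable G : graph.

Definition edges : {set {set vertex G}} :=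
  [set [set e.1; e.2] | e : vertex G * vertex G & adj e.1 e.2].

Definition line_adj : rel 'I_#|edges| :=
  fun i j => (i != j) && (enum_val i :&: enum_val j != set0).

Lemma line_adj_sym : symmetric line_adj.
Proof. by move=> i j; rewrite /line_adj eq_sym setIC. Qed.

Lemma line_adj_irr : irreflexive line_adj.
Proof. by move=> i; rewrite /line_adj eqxx. Qed.

Definition line_graph_of : graph := Graph line_adj_sym line_adj_irr.
End LineGraph.

Definition line_graph : graph_class := fun G => exists F, iso G (line_graph_of F).

(** * Turing machines *)

(* None is the blank; the bits are the input/output alphabet and [W] contains
   the auxiliary tape symbols. *)
Definition cell (W : finType) : Type := option (bool + W).

Inductive direction := Left | Stay | Right.

Record machine := Machine {
  state : finType;
  work : finType;
  start : state;
  final : pred state;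
  delta : state -> cell work -> state * cell work * direction
}.

(* One two-way infinite tape: [before] is listed from the head outwards, and
   both lists are implicitly followed by blanks. *)
Record config (M : machine) := Config {
  current : state M;
  before : seq (cell (work M));
  scanned : cell (work M);
  after : seq (cell (work M))
}.

Definition initial (M : machine) (s : seq bool) : config M :=
  let t := [seq Some (inl b) | b <- s] in
  Config (start M) [::] (head None t) (behead t).

Definition step (M : machine) (c : config M) : config M :=
  if final (current c) then c else
  let: (q, a, d) := delta (current c) (scanned c) in
  match d with
  | Left => Config q (behead (before c)) (head None (before c)) (a :: after c)
  | Stay => Config q (before c) a (after c)
  | Right => Config q (a :: before c) (head None (after c)) (behead (after c))
  end.

Fixpoint leading_bits (W : finType) (t : seq (cell W)) : seq bool :=
  if t is Some (inl b) :: t' then b :: leading_bits t' else [::].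

(* The output is the maximal block of bits that starts at the head. *)
Definition output (M : machine) (c : config M) : seq bool :=
  leading_bits (scanned c :: after c).

(* Final configurations are fixed by [step], so this says that M halts on s
   after at most t steps, with output y. *)
Definition outputs_within (M : machine) (s : seq bool) (t : nat) (y : seq bool)
  : Prop :=
  let c := iter t (@step M) (initial M s) in final (current c) /\ output c = y.

(** * Decision problems, P and NP *)

Record problem := Problem {
  instance : Type;
  code : instance -> seq bool;
  yes : instance -> Prop
}.

Definition language (L : seq bool -> Prop) : problem := Problem id L.

(* Injective: each bit of s is preceded by true, and false ends s. *)
Definition pair_code (s w : seq bool) : seq bool :=
  flatten [seq [:: true; b] | b <- s] ++ false :: w.

Definition polytime_solvable (A : problem) : Prop :=
  exists (M : machine) (p : {poly nat}), forall i : instance A,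
    exists b : bool,
      outputs_within M (code i) p.[size (code i)]%R [:: b] /\ (b <-> yes i).

(* M is the verifier, p bounds its running time and q the certificate size. *)
Definition in_NP (A : problem) : Prop :=
  exists (M : machine) (p q : {poly nat}), forall i : instance A,
    let n := size (code i) in
    (forall w : seq bool, size w <= q.[n]%R ->
       exists b : bool,
         outputs_within M (pair_code (code i) w) p.[n]%R [:: b]) /\
    (yes i <->
     exists2 w : seq bool, size w <= q.[n]%R &
       outputs_within M (pair_code (code i) w) p.[n]%R [:: true]).

Definition polytime_reduces (A B : problem) : Prop :=
  exists (M : machine) (p : {poly nat}), forall i : instance A,
    exists j : instance B,
      outputs_within M (code i) p.[size (code i)]%R (code j) /\
      (yes i <-> yes j).

Definition NP_hard (A : problem) : Prop :=
  forall L : seq bool -> Prop,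
    in_NP (language L) -> polytime_reduces (language L) A.

Definition NP_complete (A : problem) : Prop := in_NP A /\ NP_hard A.

(** * Problems on graph classes *)

(* The string is the part of the input other than the graph (for instance, the
   number of colours, or lists of colours); problems whose input is a graph
   alone ignore it. No invariance under isomorphism is imposed, since such a
   string may refer to the vertices by their numbers. *)
Definition graph_problem := graph -> seq bool -> Prop.

Definition graph_code (G : graph) : seq bool :=
  nseq (order G) true ++
  false :: [seq adj x y | x <- enum (vertex G), y <- enum (vertex G)].

(* Every instance, including those produced by a reduction to this problem,
   has its graph in C; nothing is asked of algorithms on other inputs. *)
Definition on_class (Pi : graph_problem) (C : graph_class) : problem :=
  @Problem {i : graph * seq bool | C i.1}
    (fun i => pair_code (graph_code (sval i).1) (sval i).2)
    (fun i => Pi (sval i).1 (sval i).2).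

Definition polytime_solvable_on (Pi : graph_problem) (C : graph_class) : Prop :=
  polytime_solvable (on_class Pi C).

Definition NP_complete_on (Pi : graph_problem) (C : graph_class) : Prop :=
  NP_complete (on_class Pi C).

Definition P1_P3 : graph := disjoint_union (path_graph 1) (path_graph 3).

(* [NP_complete_on Pi C] asserts membership in NP only for instances in C, so
   this record does not imply that Pi is in NP on all graphs. *)
Record C6'78_problem (Pi : graph_problem) : Prop := {
  C6' : forall H : graph,
    List.In H [:: cycle_graph 3; cycle_graph 4; cycle_graph 5;
                  copies 4 (path_graph 1);
                  disjoint_union (copies 2 (path_graph 1)) (path_graph 2);
                  copies 2 (path_graph 2)] ->
    NP_complete_on Pi (free H);
  C7 : forall H : graph,
    List.In H [:: path_graph 4; P1_P3] ->
    polytime_solvable_on Pi (free H);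
  C8 : NP_complete_on Pi line_graph
}.

(* Main.v *)
Require Import Defs.
From mathcomp Require Import all_boot.

(** A graph with no induced C_3, C_4, C_5, 4P_1, 2P_1+P_2, 2P_2 or claw has at
    most four vertices, because every graph on five vertices contains one of
    these seven; inspecting the graphs on at most four vertices, it is an induced
    subgraph of P_1+P_3 or P_4. In the remaining cases, the class of H-free graphs
    contains one of the six classes of C6', or, as line graphs are claw-free, the
    class of line graphs, and hardness passes to larger classes. *)

Set Implicit Arguments.
Unset Strict Implicit.
Unset Printing Implicit Defensive.

(** Embeddings compose and can be given by explicit maps, so the proof works with them instead of
    vertex subsets. *)
Lemma induced_subgraphP (F G : graph) :
  induced_subgraph F G <->
  exists2 f : vertex F -> vertex G,
    injective f & forall x y, adj (f x) (f y) = adj x y.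
Proof.
split=> [[S [g g_bij g_adj]] | [f f_inj f_adj]].
  exists (fun x => enum_val (g x)); last exact: g_adj.
  by move=> x y /enum_val_inj /(bij_inj g_bij).
pose S := f @: [set: vertex F].
have fS x : f x \in S by rewrite imset_f ?inE.
pose g x : vertex (induced S) := enum_rank_in (fS x) (f x).
have gK x : enum_val (g x) = f x by rewrite enum_rankK_in.
exists S; exists g => [|x y]; last by rewrite -f_adj -!gK.
apply: inj_card_bij => [x y /(congr1 enum_val)|]; first by rewrite !gK => /f_inj.
by rewrite (card_ord #|S|) card_imset // cardsT.
Qed.

Lemma induced_subgraph_trans (F G H : graph) :
  induced_subgraph F G -> induced_subgraph G H -> induced_subgraph F H.
Proof.
move=> /induced_subgraphP[f f_inj f_adj] /induced_subgraphP[g g_inj g_adj].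
apply/induced_subgraphP; exists (g \o f); first exact: inj_comp.
by move=> x y; rewrite /= g_adj f_adj.
Qed.

Lemma freeS (F H : graph) :
  induced_subgraph F H -> forall G, free F G -> free H G.
Proof. by move=> FH G F_G /(induced_subgraph_trans FH). Qed.

(** The code of an instance ignores the proof that its graph lies in the class. Here and in the next
    two lemmas the machine and the bounds therefore stay the same, and only that proof is
    replaced. *)
Lemma polytime_solvable_onS (Pi : graph_problem) (C D : graph_class) :
  (forall G, C G -> D G) ->
  polytime_solvable_on Pi D -> polytime_solvable_on Pi C.
Proof.
move=> CD [M [p Mp]]; exists M, p => -[i Ci].
exact: (Mp (exist _ i (CD _ Ci))).
Qed.

Lemma in_NP_onS (Pi : graph_problem) (C D : graph_class) :
  (forall G, C G -> D G) -> in_NP (on_class Pi D) -> in_NP (on_class Pi C).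
Proof.
move=> CD [M [p [q Mpq]]]; exists M, p, q => -[i Ci].
exact: (Mpq (exist _ i (CD _ Ci))).
Qed.

Lemma NP_hard_onS (Pi : graph_problem) (C D : graph_class) :
  (forall G, C G -> D G) -> NP_hard (on_class Pi C) -> NP_hard (on_class Pi D).
Proof.
move=> CD hardC L /hardC [M [p Mp]]; exists M, p => s.
have [[j Cj] Mj] := Mp s.
by exists (exist _ j (CD _ Cj)).
Qed.

(** The star with centre 0. *)
Definition claw_rel : rel nat := fun i j => (i == 0) (+) (j == 0).

Lemma claw_adj_sym : symmetric (fun i j : 'I_4 => claw_rel i j).
Proof. by move=> i j; rewrite /claw_rel addbC. Qed.

Lemma claw_adj_irr : irreflexive (fun i j : 'I_4 => claw_rel i j).
Proof. by move=> i; rewrite /claw_rel addbb. Qed.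

Definition claw : graph := Graph claw_adj_sym claw_adj_irr.

(** The leaves of a claw would be three pairwise disjoint edges of [F], each containing one of the
    two ends [a], [b] of the central edge; by pigeonhole two of them share an end. *)
Lemma line_graph_claw_free (G : graph) : line_graph G -> free claw G.
Proof.
move=> [F [h h_bij h_adj]] /induced_subgraphP[f f_inj f_adj].
pose e (i : 'I_4) : {set vertex F} := enum_val (h (f i)).
have meets (i j : 'I_4) : i != j -> (e i :&: e j != set0) = claw_rel i j.
  move=> neq_ij; transitivity (adj (h (f i)) (h (f j))).
    by rewrite /= /line_adj (inj_eq (bij_inj h_bij)) (inj_eq f_inj) neq_ij.
  by rewrite h_adj f_adj.
have [a [b eab]] : exists a b, e ord0 = [set a; b].
  have : e ord0 \in edges F by exact: enum_valP.
  by move=> /imsetP[[a b] _ ->]; exists a, b.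
have leaf (i : 'I_4) : i != 0 :> nat -> (a \in e i) || (b \in e i).
  move=> i_neq0; have /set0Pn[u] : e ord0 :&: e i != set0.
    by rewrite meets /claw_rel /= ?(negbTE i_neq0) // eq_sym -val_eqE.
  by rewrite eab !inE => /andP[/orP[] /eqP-> ->]; rewrite ?orbT.
have disj u (i j : 'I_4) :
  i != 0 :> nat -> j != 0 :> nat -> i != j -> u \in e i -> u \in e j -> False.
  move=> i0 j0 neq_ij ui uj.
  have : e i :&: e j != set0 by apply/set0Pn; exists u; rewrite inE ui.
  by rewrite meets // /claw_rel (negbTE i0) (negbTE j0).
pose v k : 'I_4 := inord k.
have vK k : k < 4 -> v k = k :> nat by move=> ?; rewrite inordK.
have lf k : 0 < k < 4 -> (a \in e (v k)) || (b \in e (v k)).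
  by move=> /andP[? ?]; apply: leaf; rewrite vK -?lt0n.
have dj u k l : 0 < k < 4 -> 0 < l < 4 -> k != l ->
    u \in e (v k) -> u \in e (v l) -> False.
  move=> /andP[? ?] /andP[? ?] ?.
  by apply: disj; rewrite -?val_eqE /= ?vK // -?lt0n.
have := lf 1 isT; have := lf 2 isT; have := lf 3 isT.
by move=> /orP[] u3 /orP[] u2 /orP[] u1;
  first [exact: dj u1 u2 | exact: dj u1 u3 | exact: dj u2 u3].
Qed.

(* Ordinals and [split] get stuck on opaque proofs, so the finite check below is
   computed with relations on [nat]. *)
Definition represents (G : graph) (k : nat) (a : rel nat) : Prop :=
  Defs.order G = k /\ forall x y : vertex G, adj x y = a x y.

Definition path_rel : rel nat := fun i j => (i.+1 == j) || (j.+1 == i).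

Definition cycle_rel (r : nat) : rel nat :=
  fun i j => (i != j) && ((i.+1 %% r == j) || (j.+1 %% r == i)).

Definition union_rel (n : nat) (a b : rel nat) : rel nat := fun i j =>
  if i < n then (j < n) && a i j else (n <= j) && b (i - n) (j - n).

Lemma represents_path r : represents (path_graph r) r path_rel.
Proof. by []. Qed.

Lemma represents_union G H m n a b :
  represents G m a -> represents H n b ->
  represents (disjoint_union G H) (m + n) (union_rel m a b).
Proof.
move=> [<- Ga] [<- Hb]; split=> // x y; rewrite /= /union_adj /union_rel.
case: (splitP x) => [i -> | i ->]; case: (splitP y) => [j -> | j ->].
- exact: Ga.
- by [].
- by rewrite leqNgt ltn_ord.
- by rewrite leq_addr !addKn Hb.
Qed.

(* Call-by-value evaluation stops early on [if] and [find], but not on [&&], [||]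
   and [has]. *)
Definition embeds (k : nat) (p : rel nat) (n : nat) (a : rel nat) : bool :=
  if k <= n then
    let perms := permutations (iota 0 n) in
    find (fun s => all (fun i => all (fun j => a (nth 0 s i) (nth 0 s j) == p i j)
                                     (iota 0 k)) (iota 0 k)) perms < size perms
  else false.

(** The first [k] entries of a permutation of [iota 0 n] are the values of an injection. *)
Lemma embedsP k p n a : embeds k p n a ->
  exists2 f : 'I_k -> 'I_n, injective f & forall x y, a (f x) (f y) = p x y.
Proof.
rewrite /embeds; case: ifP => // le_kn; rewrite -has_find => /hasP[s]; rewrite mem_permutations => s_perm /allP s_p.
have s_size : size s = n by rewrite (perm_size s_perm) size_iota.
have s_uniq : uniq s by rewrite (perm_uniq s_perm) iota_uniq.
have lt_s (x : 'I_k) : x < size s by rewrite s_size (leq_trans (ltn_ord x)).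
have s_lt (x : 'I_k) : nth 0 s x < n.
  by have := mem_nth 0 (lt_s x); rewrite (perm_mem s_perm) mem_iota.
exists (fun x => Ordinal (s_lt x)) => [x y [/eqP]|x y].
  by rewrite nth_uniq // => /eqP/val_inj.
have /s_p/allP : val x \in iota 0 k by rewrite mem_iota ltn_ord.
by move=> /(_ (val y)); rewrite mem_iota ltn_ord => /(_ isT)/eqP.
Qed.

Definition obstructions : seq (nat * rel nat) :=
  [:: (3, cycle_rel 3); (4, cycle_rel 4); (5, cycle_rel 5);
      (4, union_rel 1 path_rel
            (union_rel 1 path_rel (union_rel 1 path_rel path_rel)));
      (4, union_rel 2 (union_rel 1 path_rel path_rel) path_rel);
      (4, union_rel 2 path_rel path_rel); (4, claw_rel)].

Definition obstruction_graphs : seq graph :=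
  [:: cycle_graph 3; cycle_graph 4; cycle_graph 5;
      copies 4 (path_graph 1);
      disjoint_union (copies 2 (path_graph 1)) (path_graph 2);
      copies 2 (path_graph 2); claw].

Lemma obstructions_represented : List.Forall2
  (fun G o => represents G o.1 o.2) obstruction_graphs obstructions.
Proof.
repeat apply: List.Forall2_cons; last exact: List.Forall2_nil.
(* The orders of the two parts are supplied, as a numeral does not determine its summands. *)
all: rewrite /copies /=; repeat first
  [ apply: (@represents_union _ _ 1 3) | apply: (@represents_union _ _ 1 2)
  | apply: (@represents_union _ _ 1 1) | apply: (@represents_union _ _ 2 2)
  | by [] ].
Qed.

Definition classified (n : nat) (a : rel nat) : bool :=
  if find (fun o => embeds o.1 o.2 n a) obstructions < size obstructions then true
  else embeds n a 4 (union_rel 1 path_rel path_rel) || embeds n a 4 path_rel.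

(** For [i < j < n] the indices run through the numbers below ['C(n, 2)], so ['C(5, 2) = 10] bits
    serve every [n <= 5]. *)
Definition pair_index (i j : nat) : nat := 'C(j, 2) + i.

(* The bits of s are the entries of the strict upper triangle, column by column. *)
Definition bits_rel (s : bitseq) : rel nat := fun i j =>
  if i < j then nth false s (pair_index i j)
  else if j < i then nth false s (pair_index j i) else false.

Fixpoint all_bits (n : nat) (P : bitseq -> bool) : bool :=
  if n is n'.+1 then
    all_bits n' (fun s => P (true :: s)) && all_bits n' (fun s => P (false :: s))
  else P [::].

Lemma all_bitsP n P s : all_bits n P -> size s = n -> P s.
Proof.
elim: n P s => [|n IHn] P [|b s] //= /andP[Pt Pf] [s_n].
by case: b; [exact: (IHn _ _ Pt) | exact: (IHn _ _ Pf)].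
Qed.

(** For [n = 5] this says that an obstruction always occurs, since [embeds 5 _ 4 _] is false. *)
Lemma classified_upto5 :
  all (fun n => all_bits 10 (fun s => classified n (bits_rel s))) (iota 0 6).
Proof. vm_cast_no_check (erefl true). Qed.

Lemma Forall2_has (S T : Type) (R : S -> T -> Prop) (p : pred T) u v :
  List.Forall2 R u v -> has p v ->
  exists x y, [/\ List.In x u, R x y & p y].
Proof.
elim=> //= x y u' v' Rxy _ IH /orP[py | /IH[x' [y' [x'u Rxy' py']]]].
  by exists x, y; split=> //; left.
by exists x', y'; split=> //; right.
Qed.

Lemma bits_rel_surj (a : rel nat) : symmetric a -> irreflexive a ->
  exists2 s, size s = 10 &
    forall i j, i < 5 -> j < 5 -> a i j = bits_rel s i j.
Proof.
move=> a_sym a_irr.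
exists [:: a 0 1; a 0 2; a 1 2; a 0 3; a 1 3; a 2 3; a 0 4; a 1 4; a 2 4; a 3 4] => //.
move=> [|[|[|[|[|i]]]]] [|[|[|[|[|j]]]]] // _ _;
  by [ | exact: a_irr | exact: a_sym].
Qed.

(** The first five vertices decide: an obstruction among them is one in [H], and if there is none,
    then [H] has at most four vertices and the finite check covers all of it. *)
Lemma graph_classification (H : graph) :
  (exists F, List.In F obstruction_graphs /\ induced_subgraph F H) \/
  (induced_subgraph H P1_P3 \/ induced_subgraph H (path_graph 4)).
Proof.
(* Extending adjacency by [false] gives ten bits even when [H] has fewer than five vertices. *)
pose a : rel nat := fun i j =>
  if (insub i : option (vertex H), insub j : option (vertex H)) is (Some x, Some y)
  then adj x y else false.
have aE (x y : vertex H) : a x y = adj x y by rewrite /a !valK.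
have a_sym : symmetric a.
  by move=> i j; rewrite /a; case: insub => [x|]; case: insub => // y; rewrite adj_sym.
have a_irr : irreflexive a.
  by move=> i; rewrite /a; case: insub => // x; rewrite adj_irr.
have [s s_size aS] := bits_rel_surj a_sym a_irr.
pose n := minn (Defs.order H) 5.
have le_nH : n <= Defs.order H by rewrite geq_minl.
have le_n5 : n <= 5 by rewrite geq_minr.
have sE (x y : 'I_n) : bits_rel s x y = adj (widen_ord le_nH x) (widen_ord le_nH y).
  by rewrite -aE aS // (leq_trans (ltn_ord _) le_n5).
have : classified n (bits_rel s).
  have /allP/(_ n) := classified_upto5; rewrite mem_iota ltnS le_n5 => /(_ isT).
  by move/all_bitsP; apply.
rewrite /classified; case: ifP => [obstr _ | _ small]; [left | right].
  move: obstr; rewrite -has_find => /(Forall2_has obstructions_represented).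
  move=> [F [[k p] [F_obs [/= <- Fp] /embedsP[f f_inj f_adj]]]].
  exists F; split=> //; apply/induced_subgraphP.
  exists (widen_ord le_nH \o f) => [x y /(congr1 val) /= /val_inj /f_inj //|x y].
  by rewrite /= -sE f_adj Fp.
(* [embeds n _ 4 _] holds only if [n <= 4]; the minimum [n] is then not 5, so it is the order of
   [H]. *)
have le_n4 : n <= 4 by case/orP: small; rewrite /embeds; case: ifP.
have nH : n = Defs.order H by apply/minn_idPl; move: le_n4; rewrite geq_min => /orP[/leqW|].
have widenE (G : graph) q : represents G 4 q -> embeds n (bits_rel s) 4 q ->
    induced_subgraph H G.
  move=> [oG Gq] /embedsP[f f_inj f_adj]; apply/induced_subgraphP.
  exists (fun x => cast_ord (esym oG) (f (cast_ord (esym nH) x))) => [x y|x y].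
    by move/cast_ord_inj/f_inj/cast_ord_inj.
  rewrite Gq /= f_adj sE; congr adj; exact: val_inj.
have P4_rep := represents_path 4.
have P13_rep := represents_union (represents_path 1) (represents_path 3).
by case/orP: small => [/(widenE _ _ P13_rep) | /(widenE _ _ P4_rep)]; [left | right].
Qed.

Theorem theorem3 (Pi : graph_problem)
    (Pi_in_NP : in_NP (on_class Pi all_graphs))
    (Pi_C6'78 : C6'78_problem Pi)
    (H : graph) :
  (induced_subgraph H P1_P3 \/ induced_subgraph H (path_graph 4) ->
     polytime_solvable_on Pi (free H)) /\
  (~ (induced_subgraph H P1_P3 \/ induced_subgraph H (path_graph 4)) ->
     NP_complete_on Pi (free H)).
Proof.
have [hard easy hard_line] := Pi_C6'78; split=> [H_small | H_large].
  case: H_small => /freeS/polytime_solvable_onS; apply; apply: easy.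
    by right; left.
  by left.
(* Membership in NP descends from all graphs; it cannot come from the class giving hardness, which
   lies inside [free H]. *)
split; first exact: (in_NP_onS (D := all_graphs)) Pi_in_NP.
have [[F [F_obs FH]] | //] := graph_classification H.
have [/hard[_ hardF] | F_claw] :
    List.In F (take 6 obstruction_graphs) \/ claw = F.
  by move: F_obs => /=; tauto.
- exact: NP_hard_onS (freeS FH) hardF.
- apply: NP_hard_onS hard_line.2 => G /line_graph_claw_free.
  by apply: freeS; rewrite F_claw.
Qed.
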